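(* There exists a graph $H$ that is not isomorphic to its complement $\overline{H}$, but such that $H$ and $\overline{H}$ are cospectral with respect to each of the following four matrices: the adjacency matrix $\mathrm{Adj}$, the Laplacian $L=D-\mathrm{Adj}$, the signless Laplacian $Q=D+\mathrm{Adj}$, and the normalized Laplacian $\mathcal{L}=D^{-1/2}(D-\mathrm{Adj})D^{-1/2}$.
   Context: All graphs are finite, simple and undirected. $\mathrm{Adj}$ denotes the adjacency matrix of a graph and $D$ its diagonal matrix of degrees. In the normalized Laplacian, by convention an isolated vertex contributes an eigenvalue $0$ (its row and column in $\mathcal{L}$ are zero). Two graphs are cospectral with respect to a matrix if the associated matrices have the same eigenvalues with the same multiplicities. *)

(* Defs.v *)
From mathcomp Require Import all_boot all_order all_algebra.
From mathcomp Require Import reals.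

Set Implicit Arguments.
Unset Strict Implicit.
Unset Printing Implicit Defensive.

Import Order.TTheory GRing.Theory Num.Theory.
Local Open Scope ring_scope.

Record sgraph (n : nat) := SGraph {
  edge : rel 'I_n;
  edge_sym : symmetric edge;
  edge_irr : irreflexive edge
}.

Section Complement.
Variables (n : nat) (G : sgraph n).

Definition compl_edge : rel 'I_n := [rel x y | (x != y) && ~~ edge G x y].

Fact compl_edge_sym : symmetric compl_edge.
Proof. by move=> x y; rewrite /compl_edge /= eq_sym edge_sym. Qed.

Fact compl_edge_irr : irreflexive compl_edge.
Proof. by move=> x; rewrite /compl_edge /= eqxx. Qed.

Definition compl : sgraph n := SGraph compl_edge_sym compl_edge_irr.

End Complement.

Definition isomorphic (m n : nat) (G : sgraph m) (H : sgraph n) : Prop :=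
  exists f : 'I_m -> 'I_n,
    bijective f /\ forall x y, edge H (f x) (f y) = edge G x y.

Definition degree (n : nat) (G : sgraph n) (x : 'I_n) : nat :=
  #|[set y | edge G x y]|.

Section Matrices.
Variables (R : realType) (n : nat) (G : sgraph n).

Definition adj_mx : 'M[R]_n := \matrix_(x, y) (edge G x y)%:R.

Definition deg_mx : 'M[R]_n := diag_mx (\row_x (degree G x)%:R).

(* D^(-1/2).  Since 0^-1 = 0 in a field, the entry of an isolated vertex is 0, *)
(* so that its row and column in the normalized Laplacian vanish.              *)
Definition deg_mx_invsqrt : 'M[R]_n :=
  diag_mx (\row_x (Num.sqrt (degree G x)%:R)^-1).

Definition laplacian_mx : 'M[R]_n := deg_mx - adj_mx.

Definition signless_laplacian_mx : 'M[R]_n := deg_mx + adj_mx.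

Definition normalized_laplacian_mx : 'M[R]_n :=
  deg_mx_invsqrt *m (deg_mx - adj_mx) *m deg_mx_invsqrt.

End Matrices.

(* Same eigenvalues with the same (algebraic) multiplicities; the multiplicity *)
(* is 0 when a is not an eigenvalue.  The matrices above are real symmetric,   *)
(* so all their eigenvalues are in R, and algebraic and geometric              *)
(* multiplicities agree.                                                       *)
Definition same_spectrum (R : realType) (m n : nat) (A : 'M[R]_m) (B : 'M[R]_n)
    : Prop :=
  forall a : R, mup a (char_poly A) = mup a (char_poly B).

(* Main.v *)
Require Import Defs.
From mathcomp Require Import all_boot all_order all_algebra.
From mathcomp Require Import reals.

Set Implicit Arguments.
Unset Strict Implicit.
Unset Printing Implicit Defensive.

Import Order.TTheory GRing.Theory Num.Theory.
Local Open Scope ring_scope.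

(** Godsil-McKay switching of [H] with respect to [C = {0, 1, 2, 3}] (a
    perfect matching to which every other vertex sends exactly two edges)
    yields a graph [H'] that is isomorphic to the complement of [H].  Hence the
    switching matrix followed by the permutation [H' -> compl H] intertwines
    the two adjacency matrices.  The degree is constant on [C] and is preserved
    by the switching, so the same matrix intertwines every function of the
    degree matrices, and thus all four matrices at once.  The graphs are not
    isomorphic because an edge of [H] has four common neighbours, whereas
    no edge of [compl H] has more than three. *)

(** Over the polynomial ring, $(X - A) V = V (X - B)$; take determinants and cancel the nonzero
    constant $\det V$. *)
Lemma char_poly_intertwine (F : fieldType) (n : nat) (V A B : 'M[F]_n) :
  V \in unitmx -> A *m V = V *m B -> char_poly A = char_poly B.
Proof.
rewrite unitmxE unitfE => detV0 AV.
have detVP0 : \det (map_mx polyC V) != 0 by rewrite det_map_mx polyC_eq0.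
apply: (mulIf detVP0); rewrite /char_poly -det_mulmx [RHS]mulrC -det_mulmx.
by rewrite /char_poly_mx mulmxBl mulmxBr -!map_mxM AV scalar_mxC.
Qed.

Lemma same_spectrum_intertwine (R : realType) (n : nat) (V A B : 'M[R]_n) :
  V \in unitmx -> A *m V = V *m B -> same_spectrum A B.
Proof. by move=> Vu AV a; rewrite (char_poly_intertwine Vu AV). Qed.

(** Entry [(x, y)] is [V x y] times [f] of the degree of [x] on the left and of [y] on the right;
    these degrees agree wherever [V x y] is nonzero. *)
Lemma intertwine_deg_fun (R : realType) (n : nat) (G H : sgraph n)
    (V : 'M[R]_n) (f : nat -> R) :
  (forall x y, V x y != 0 -> degree G x = degree H y) ->
  diag_mx (\row_x f (degree G x)) *m V = V *m diag_mx (\row_x f (degree H x)).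
Proof.
move=> V_deg; apply/matrixP=> x y; rewrite mul_diag_mx mul_mx_diag !mxE mulrC.
by have [->|/V_deg->] := eqVneq (V x y) 0; rewrite ?mul0r.
Qed.

Lemma intertwine_same_spectra (R : realType) (n : nat) (G H : sgraph n)
    (V : 'M[R]_n) :
  V \in unitmx -> adj_mx R G *m V = V *m adj_mx R H ->
  (forall x y, V x y != 0 -> degree G x = degree H y) ->
  same_spectrum (adj_mx R G) (adj_mx R H) /\
  same_spectrum (laplacian_mx R G) (laplacian_mx R H) /\
  same_spectrum (signless_laplacian_mx R G) (signless_laplacian_mx R H) /\
  same_spectrum (normalized_laplacian_mx R G) (normalized_laplacian_mx R H).
Proof.
move=> V_unit V_adj V_deg.
have V_degmx : deg_mx R G *m V = V *m deg_mx R H.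
  exact: (intertwine_deg_fun (fun d => d%:R)).
have V_inv : deg_mx_invsqrt R G *m V = V *m deg_mx_invsqrt R H.
  exact: (intertwine_deg_fun (fun d => (Num.sqrt d%:R)^-1)).
split; [|split; [|split]]; apply: (same_spectrum_intertwine V_unit).
- exact: V_adj.
- by rewrite /laplacian_mx mulmxBl mulmxBr V_degmx V_adj.
- by rewrite /signless_laplacian_mx mulmxDl mulmxDr V_degmx V_adj.
(* [V] moves left past the three factors in turn. *)
- rewrite /normalized_laplacian_mx -mulmxA V_inv !mulmxA.
  by rewrite -(mulmxA _ _ V) mulmxBl V_degmx V_adj -mulmxBr mulmxA V_inv.
Qed.

Definition codegree (n : nat) (G : sgraph n) (x y : 'I_n) : nat :=
  #|[set z | edge G x z && edge G y z]|.

(** An isomorphism maps the common neighbours of [x] and [y] bijectively onto those of their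
    images. *)
Lemma codegree_iso (m n : nat) (G : sgraph m) (H : sgraph n) (f : 'I_m -> 'I_n)
    (x y : 'I_m) :
  bijective f -> (forall u v, edge H (f u) (f v) = edge G u v) ->
  codegree H (f x) (f y) = codegree G x y.
Proof.
move=> bij_f f_edge; rewrite -[RHS](card_imset _ (bij_inj bij_f)).
case: bij_f => g fK gK; apply: eq_card => z; rewrite -(gK z).
by rewrite (mem_imset _ _ (can_inj fK)) !inE !f_edge.
Qed.

(** Replaces the locked big operator by a fold that [vm_compute] can evaluate. *)
Lemma sum_ord_foldr (V : nmodType) (n : nat) (F : nat -> V) :
  \sum_(i < n) F i = foldr (fun i s => F i + s) 0 (iota 0 n).
Proof. by rewrite -(big_mkord xpredT F) unlock /index_iota subn0. Qed.

Lemma card_ord_count (n : nat) (p : pred nat) :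
  #|[set i : 'I_n | p i]| = count p (iota 0 n).
Proof. by rewrite cardsE cardE size_filter -val_enum_ord count_map -enumT. Qed.

(** Ranges over natural numbers instead of ordinals, so that finite checks reduce to plain
    computation. *)
Definition all2_ord (n : nat) (p : nat -> nat -> bool) : bool :=
  all (fun i => all (p i) (iota 0 n)) (iota 0 n).

Lemma all2_ordP (n : nat) (p : nat -> nat -> bool) :
  all2_ord n p -> forall i j : 'I_n, p i j.
Proof.
move=> /allP p_all i j; have ilt : val i \in iota 0 n by rewrite mem_iota /=.
by apply: (allP (p_all _ ilt)); rewrite mem_iota /=.
Qed.

(** Entry [i] lists the neighbours of vertex [i]; the matching on [C] consists of the edges 0-3 and
    1-2. *)
Definition nbrs12 : seq (seq nat) :=
  [:: [:: 3; 4; 6; 9; 10];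
      [:: 2; 5; 7; 10; 11];
      [:: 1; 4; 7; 8; 9];
      [:: 0; 5; 6; 8; 11];
      [:: 0; 2; 5; 6; 10; 11];
      [:: 1; 3; 4; 7; 8; 11];
      [:: 0; 3; 4; 7; 9; 10];
      [:: 1; 2; 5; 6; 8; 9];
      [:: 2; 3; 5; 7; 9];
      [:: 0; 2; 6; 7; 8; 11];
      [:: 0; 1; 4; 6; 11];
      [:: 1; 3; 4; 5; 9; 10]]%N.

Definition adj12 (i j : nat) : bool := j \in nth [::] nbrs12 i.

Definition coadj12 (i j : nat) : bool := (i != j) && ~~ adj12 i j.

Definition edge12 : rel 'I_12 := fun x y => adj12 x y.

Fact edge12_sym : symmetric edge12.
Proof.
move=> x y; apply/eqP; move: x y.
by apply: (@all2_ordP 12 (fun i j => adj12 i j == adj12 j i)); vm_compute.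
Qed.

Fact edge12_irr : irreflexive edge12.
Proof.
have irr : all2_ord 12 (fun i j => (i == j) ==> ~~ adj12 i j) by vm_compute.
by move=> x; apply/negbTE; have := all2_ordP irr x x; rewrite eqxx.
Qed.

Definition graph12 : sgraph 12 := SGraph edge12_sym edge12_irr.

Lemma compl_graph12E (x y : 'I_12) : edge (compl graph12) x y = coadj12 x y.
Proof. by []. Qed.

Lemma degree_graph12 (x : 'I_12) :
  degree graph12 x = count (adj12 x) (iota 0 12).
Proof. exact: card_ord_count. Qed.

Lemma degree_compl_graph12 (x : 'I_12) :
  degree (compl graph12) x = count (coadj12 x) (iota 0 12).
Proof. exact: (card_ord_count _ (coadj12 x)). Qed.

Lemma codegree_graph12 (x y : 'I_12) :
  codegree graph12 x y = count (fun k => adj12 x k && adj12 y k) (iota 0 12).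
Proof. exact: (card_ord_count _ (fun k => adj12 x k && adj12 y k)). Qed.

Lemma codegree_compl_graph12 (x y : 'I_12) :
  codegree (compl graph12) x y =
    count (fun k => coadj12 x k && coadj12 y k) (iota 0 12).
Proof. exact: (card_ord_count _ (fun k => coadj12 x k && coadj12 y k)). Qed.

Lemma graph12_not_iso_compl : ~ isomorphic graph12 (compl graph12).
Proof.
(* The edge 0-6 has the four common neighbours 3, 4, 9 and 10. *)
case=> f [bij_f f_edge]; pose x : 'I_12 := inord 0; pose y : 'I_12 := inord 6.
have := codegree_iso x y bij_f f_edge.
have: coadj12 (f x) (f y).
  by rewrite -compl_graph12E f_edge /= /edge12 !inordK.
rewrite codegree_graph12 codegree_compl_graph12 !inordK //.
have cod : all2_ord 12 (fun i j => coadj12 i j ==>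
    (count (fun k => coadj12 i k && coadj12 j k) (iota 0 12) <= 3)%N).
  by vm_compute.
by move/(implyP (all2_ordP cod _ _)) => + cod4; rewrite cod4.
Qed.

(* Twice the product [S P], where [S] is [J/2 - I] on [{0, 1, 2, 3}] and the
   identity elsewhere, and [P] is the matrix of the permutation
   [(0 4) (1 5) (2 6) (3 7) (8 9 10 11)]. *)
Definition gm12 (i j : nat) : int :=
  if (i < 4)%N then
    if (4 <= j < 8)%N then 1 - (j == i + 4)%N%:R *+ 2 else 0
  else (j == nth 0 [:: 4; 5; 6; 7; 0; 1; 2; 3; 9; 10; 11; 8] i)%N%:R *+ 2.

Definition gm12_mx (R : realType) : 'M[R]_12 :=
  \matrix_(i, j) (gm12 i j)%:~R.

Lemma gm12_mx_adj (R : realType) :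
  adj_mx R graph12 *m gm12_mx R = gm12_mx R *m adj_mx R (compl graph12).
Proof.
(* Each entry is compared by computation in [int], then carried to [R] by the ring morphism
   [intr]. *)
have eqAV : all2_ord 12 (fun i j =>
    foldr (fun k s => (adj12 i k)%:R * gm12 k j + s) 0 (iota 0 12) ==
    foldr (fun k s => gm12 i k * (coadj12 k j)%:R + s) 0 (iota 0 12)).
  by vm_compute.
apply/matrixP=> i j; rewrite !mxE.
have /eqP/(congr1 (intr : int -> R)) := all2_ordP eqAV i j.
rewrite -(sum_ord_foldr _ (fun k => (adj12 i k)%:R * gm12 k j)).
rewrite -(sum_ord_foldr _ (fun k => gm12 i k * (coadj12 k j)%:R)).
rewrite !rmorph_sum /= => eq_ij.
under eq_bigr do rewrite !mxE.
under [RHS]eq_bigr do rewrite !mxE compl_graph12E.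
under eq_bigr do rewrite -[_%:R]mulrz_nat -intrM.
by under [RHS]eq_bigr do rewrite -[_%:R]mulrz_nat -intrM.
Qed.

(** [S] and [P] are orthogonal, since $(J/2 - I)^2 = I$ for blocks of size 4; so twice their
    product, times its transpose, is $4I$. *)
Lemma gm12_mx_unit (R : realType) : gm12_mx R \in unitmx.
Proof.
have VVt : all2_ord 12 (fun i j =>
    foldr (fun k s => gm12 i k * gm12 j k + s) 0 (iota 0 12) ==
    (i == j)%:R *+ 4).
  by vm_compute.
suff: gm12_mx R *m (4^-1 *: (gm12_mx R)^T) = 1%:M by case/mulmx1_unit.
rewrite -scalemxAr; apply: (canLR (scalerK _)); first by rewrite pnatr_eq0.
apply/matrixP=> i j; rewrite !mxE.
have /eqP/(congr1 (intr : int -> R)) := all2_ordP VVt i j.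
rewrite -(sum_ord_foldr _ (fun k => gm12 i k * gm12 j k)) rmorph_sum /=.
under eq_bigr do rewrite intrM.
under [X in _ -> X = _]eq_bigr do rewrite !mxE.
by move->; rewrite rmorphMn /= mulrz_nat mulr_natl.
Qed.

(** Rows 0 to 3 are supported on columns 4 to 7, and all degrees involved are 5; every other row has
    a single nonzero entry, given by [P]. *)
Lemma gm12_mx_degree (R : realType) (x y : 'I_12) :
  gm12_mx R x y != 0 -> degree graph12 x = degree (compl graph12) y.
Proof.
have deg_eq : all2_ord 12 (fun i j => (gm12 i j != 0) ==>
    (count (adj12 i) (iota 0 12) == count (coadj12 j) (iota 0 12))).
  by vm_compute.
rewrite mxE intr_eq0 degree_graph12 degree_compl_graph12 => Vxy.
exact/eqP/(implyP (all2_ordP deg_eq x y)).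
Qed.

Theorem mainTheorem5 (R : realType) :
  exists (n : nat) (H : sgraph n),
    ~ isomorphic H (compl H) /\
    same_spectrum (adj_mx R H) (adj_mx R (compl H)) /\
    same_spectrum (laplacian_mx R H) (laplacian_mx R (compl H)) /\
    same_spectrum (signless_laplacian_mx R H)
      (signless_laplacian_mx R (compl H)) /\
    same_spectrum (normalized_laplacian_mx R H)
      (normalized_laplacian_mx R (compl H)).
Proof.
exists 12, graph12; split; first exact: graph12_not_iso_compl.
exact: (intertwine_same_spectra (gm12_mx_unit R) (gm12_mx_adj R)
          (@gm12_mx_degree R)).
Qed.
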